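(* Let $\mathcal{R}\subseteq K(\mathrm{Var})$ be the subring spanned by the classes $[Y_G]$ of the affine graph hypersurface complements, as $G$ ranges over all finite graphs, and let $\varphi: K(\mathrm{Var})\to \mathbb{Z}[SB]$ be the Larsen–Lunts homomorphism. Then $\varphi(\mathcal{R})$ is the subring $\mathbb{Z}\subseteq \mathbb{Z}[SB]$ generated by the stable birational equivalence class of a point. That is, the images of the affine graph hypersurface complements span $\mathbb{Z}\subseteq\mathbb{Z}[SB]$.
   Context: Graphs are finite; looping edges and multiple edges are allowed, and graphs need not be connected. For a connected graph $G$ with edges $e_1,\dots,e_n$ and corresponding variables $t_1,\dots,t_n$, the graph polynomial is $\psi_G(t_1,\dots,t_n)=\sum_{T\subseteq G}\prod_{e\notin T}t_e$, where $T$ runs over the spanning trees of $G$ and $t_e$ is the variable of the edge $e$. For a general finite graph, $\psi_G$ is the product of the graph polynomials of its connected components. Let $\widehat X_G\subset\mathbb{A}^n$ be the affine hypersurface $\{\psi_G=0\}$ and $Y_G=\mathbb{A}^n\smallsetminus\widehat X_G$ the affine graph hypersurface complement. $K(\mathrm{Var})$ is the Grothendieck ring of varieties over $\mathbb{Q}$: it is generated by isomorphism classes of quasi-projective varieties, with relations $[X]=[X\smallsetminus Y]+[Y]$ for closed embeddings $Y\subseteq X$ and product $[X]\cdot[Y]=[X\times Y]$. Products of classes $[Y_G]$ are again of this form ($[Y_{G_1}][Y_{G_2}]=[Y_{G_1\amalg G_2}]$), so the additive span of the classes $[Y_G]$ is a subring. Two irreducible varieties $X,Y$ are stably birational if $X\times\mathbb{P}^k$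 is birational to $Y\times\mathbb{P}^\ell$ for some $k,\ell\ge 0$. The stable birational equivalence classes $[V]_{SB}$ form a multiplicative monoid $SB$ under products, with unit the class of a point, and $\mathbb{Z}[SB]$ is its monoid ring. The Larsen–Lunts homomorphism $\varphi: K(\mathrm{Var})\to\mathbb{Z}[SB]$ is the ring homomorphism determined by $\varphi([V])=[V]_{SB}$ for every irreducible smooth projective variety $V$. (It is a known theorem that $\varphi$ is well defined and induces an isomorphism $K(\mathrm{Var})/(\mathbb{L})\cong\mathbb{Z}[SB]$, where $\mathbb{L}=[\mathbb{A}^1]$. For $V$ singular or non-complete, $\varphi([V])$ need not equal $[V]_{SB}$.)
   Formalization: Over Q a product of irreducible varieties can be reducible (Spec Q(i) with itself), so SB is not literally a monoid; the product of two classes in Z[SB] is taken to be the sum of the classes of the irreducible components of the product variety. *)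

(* Defs.v *)
From HB Require Import structures.
From mathcomp Require Import all_boot all_order all_algebra all_field.
From mathcomp Require Import finmap.
From mathcomp Require Import boolp classical_sets.
From mathcomp Require Import monalg.
From mathcomp Require Import mpoly.
From mathcomp Require Import generic_quotient ring_quotient.
From Stdlib Require Import Relations.

Set Implicit Arguments.
Unset Strict Implicit.
Unset Printing Implicit Defensive.

Import Order.TTheory GRing.Theory Num.Theory.
Local Open Scope ring_scope.
Local Open Scope classical_set_scope.
Local Open Scope quotient_scope.

(* Notation for mpoly's type: "{mpoly rat[N]}" is also claimed by monalg. *)
Notation Qpoly N := (mpoly N rat).

(* As Q is perfect, a reduced quasi-projective Q-scheme is the same thing   *)
(* as a subset of projective space over the algebraic closure algC of Q     *)
(* that is locally closed for the Zariski topology defined by polynomials   *)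
(* with coefficients in Q, and its morphisms over Q are the maps on points  *)
(* that are locally given by such polynomials.                              *)
(*                                                                          *)
(* A point of P^(N-1) is represented by the nonzero vectors of 'rV[algC]_N  *)
(* on a line, and a subset of P^(N-1) by the corresponding cone without its *)
(* origin.                                                                  *)

Definition peval N (p : Qpoly N) (v : 'rV[algC]_N) : algC :=
  (map_mpoly ratr p).@[v 0].

Definition homogeneous N (p : Qpoly N) : Prop := exists d, p \is d.-homog.

Definition pzeros N (s : seq (Qpoly N)) : set 'rV[algC]_N :=
  [set v | v != 0 /\ forall p, p \in s -> peval p v = 0].

Definition zclosed N (A : set 'rV[algC]_N) : Prop :=
  exists2 s : seq (Qpoly N), (forall p, p \in s -> homogeneous p)
                           & A = pzeros s.

Record qpvar N := QPVar {
  pts :> set 'rV[algC]_N;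
  pts_lc : exists A B, [/\ zclosed A, zclosed B & pts = A `\` B]
}.

Definition closed_in N (Y X : set 'rV[algC]_N) : Prop :=
  exists2 A, zclosed A & Y = X `&` A.

Definition open_in N (U X : set 'rV[algC]_N) : Prop :=
  exists2 A, zclosed A & U = X `\` A.

Definition proj_eq N (u v : 'rV[algC]_N) : Prop :=
  exists2 c : algC, c != 0 & u = c *: v.

Definition polymap N M (F : 'I_M -> Qpoly N) (v : 'rV[algC]_N) : 'rV[algC]_M :=
  \row_i peval (F i) v.

(* Near x, f is given by homogeneous polynomials of the same degree; the    *)
(* neighbourhood is the set where these do not all vanish.                  *)
Definition morphism N M (X : qpvar N) (Y : qpvar M)
    (f : 'rV[algC]_N -> 'rV[algC]_M) : Prop :=
  (forall x, pts X x -> pts Y (f x)) /\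
  (forall x, pts X x -> exists d (F : 'I_M -> Qpoly N),
     [/\ forall i, F i \is d.-homog,
         polymap F x != 0 &
         forall y, pts X y -> polymap F y != 0 -> proj_eq (f y) (polymap F y)]).

Definition isomorphic N M (X : qpvar N) (Y : qpvar M) : Prop :=
  exists f g, [/\ morphism X Y f, morphism Y X g,
    forall x, pts X x -> proj_eq (g (f x)) x & forall y, pts Y y -> proj_eq (f (g y)) y].

Definition irreducible N (X : set 'rV[algC]_N) : Prop :=
  X !=set0 /\ forall A B, zclosed A -> zclosed B ->
    X `<=` A `|` B -> X `<=` A \/ X `<=` B.

(* Smoothness over Q, as local existence of a presentation by r equations   *)
(* with independent differentials. The differentials are those of the       *)
(* homogeneous equations: by Euler's relation, their Jacobian matrix at a   *)
(* zero has the same rank as the one in an affine chart.                    *)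
Definition smooth N (X : set 'rV[algC]_N) : Prop :=
  forall x, X x -> exists r (f : 'I_r -> Qpoly N) (B : set 'rV[algC]_N),
    [/\ forall i, homogeneous (f i), zclosed B, ~ B x,
        X `\` B = pzeros (codom f) `\` B &
        row_free (\matrix_(i < r, j < N) peval (mderiv j (f i)) x)].

Lemma pevalD N (p q : Qpoly N) v : peval (p + q) v = peval p v + peval q v.
Proof. by rewrite /peval !rmorphD. Qed.

Lemma pevalB N (p q : Qpoly N) v : peval (p - q) v = peval p v - peval q v.
Proof. by rewrite /peval !rmorphB. Qed.

Lemma pevalM N (p q : Qpoly N) v : peval (p * q) v = peval p v * peval q v.
Proof. by rewrite /peval !rmorphM. Qed.

Lemma pevalXU N (i : 'I_N) v : peval ('X_i : Qpoly N) v = v 0 i.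
Proof. by rewrite /peval map_mpolyX mevalXU. Qed.

Lemma pevalE N (p : Qpoly N) v :
  peval p v = \sum_(m <- msupp p) ratr p@_m * \prod_i v 0 i ^+ m i.
Proof.
rewrite {1}[p]mpolyE /peval (raddf_sum (map_mpoly ratr)) (raddf_sum (meval _)) /=.
apply: eq_bigr => m _.
by rewrite map_mpolyZ mevalZ map_mpolyX mevalX.
Qed.

Lemma peval_scale N d (p : Qpoly N) c v :
  p \is d.-homog -> peval p (c *: v) = c ^+ d * peval p v.
Proof.
move=> /dhomogP hp; rewrite !pevalE big_distrr /= !big_seq.
apply: eq_bigr => m /hp /= <-; rewrite mulrCA; congr (_ * _).
rewrite mdegE -prodrXr -big_split /=.
by apply: eq_bigr => i _; rewrite mxE exprMn.
Qed.

Lemma homogeneousM N (p q : Qpoly N) :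
  homogeneous p -> homogeneous q -> homogeneous (p * q).
Proof. by move=> [d hp] [e hq]; exists (d + e)%N; apply: dhomogM. Qed.

Lemma homogeneousXU N (i : 'I_N) : homogeneous ('X_i : Qpoly N).
Proof. by exists 1%N; rewrite dhomogX; apply/eqP/mdeg1. Qed.

Lemma pzeros_nil N : pzeros [::] = [set v : 'rV[algC]_N | v != 0].
Proof. by apply/seteqP; split=> [v []|v] //= v0; split. Qed.

Lemma zclosed_all N : zclosed [set v : 'rV[algC]_N | v != 0].
Proof. by exists [::]; rewrite ?pzeros_nil. Qed.

Lemma zclosed_pzeros1 N (p : Qpoly N) : homogeneous p -> zclosed (pzeros [:: p]).
Proof. by move=> hp; exists [:: p] => // q; rewrite inE => /eqP->. Qed.

Lemma zclosedI N (A B : set 'rV[algC]_N) :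
  zclosed A -> zclosed B -> zclosed (A `&` B).
Proof.
move=> [s hs ->] [t ht ->]; exists (s ++ t).
  by move=> p; rewrite mem_cat => /orP[/hs|/ht].
apply/seteqP; split=> v /=.
  by move=> [[v0 vs] [_ vt]]; split=> // p; rewrite mem_cat => /orP[/vs|/vt].
by move=> [v0 h]; split; split=> // p hp; apply: h; rewrite mem_cat hp ?orbT.
Qed.

Lemma zclosedU N (A B : set 'rV[algC]_N) :
  zclosed A -> zclosed B -> zclosed (A `|` B).
Proof.
move=> [s hs ->] [t ht ->]; exists [seq p * q | p <- s, q <- t].
  by move=> _ /allpairsP[[p q] /= [/hs hp /ht hq ->]]; apply: homogeneousM.
apply/seteqP; split=> v /=.
  case=> -[v0 h]; split=> // _ /allpairsP[[p q] /= [hp hq ->]]; rewrite pevalM.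
    by rewrite (h p hp) mul0r.
  by rewrite (h q hq) mulr0.
move=> [v0 h]; have [/allP hS|/allPn[p sp np]] :=
  boolP (all (fun p => peval p v == 0) s).
  by left; split=> // p /hS /eqP.
right; split=> // q tq; apply/eqP; have /eqP := h _ (allpairs_f *%R sp tq).
by rewrite pevalM mulf_eq0 (negPf np).
Qed.

Lemma zclosed_scale N (A : set 'rV[algC]_N) c v :
  zclosed A -> c != 0 -> A v -> A (c *: v).
Proof.
move=> [s hs ->] c0 [v0 vs]; split; first by rewrite scaler_eq0 negb_or c0.
by move=> p sp; have [d hd] := hs p sp; rewrite (peval_scale _ _ hd) vs ?mulr0.
Qed.

Lemma zclosed_scaleE N (A : set 'rV[algC]_N) c v :
  zclosed A -> c != 0 -> A (c *: v) <-> A v.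
Proof.
move=> hA c0; split=> [h|]; last exact: zclosed_scale.
by rewrite -[v]scale1r -(mulVf c0) -scalerA; apply: zclosed_scale; rewrite ?invr_eq0.
Qed.

Lemma qpvar_scale N (X : qpvar N) c v : c != 0 -> pts X (c *: v) <-> pts X v.
Proof.
case: (pts_lc X) => A [B [hA hB ->]] c0 /=.
by split=> -[/(zclosed_scaleE _ hA c0) h1 h2]; split=> // /(zclosed_scaleE _ hB c0).
Qed.

Lemma qpvar_neq0 N (X : qpvar N) v : pts X v -> v != 0.
Proof. by case: (pts_lc X) => A [B [[s _ ->] _ ->]] [[]]. Qed.

Lemma qpvar_inj N (X Y : qpvar N) : X = Y :> set _ -> X = Y.
Proof.
by case: X Y => X hX [Y hY] /= e; subst Y; congr QPVar; apply: Prop_irrelevance.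
Qed.

Lemma peval_sum N (I : Type) (r : seq I) P (F : I -> Qpoly N) v :
  peval (\sum_(i <- r | P i) F i) v = \sum_(i <- r | P i) peval (F i) v.
Proof. by rewrite /peval (raddf_sum (map_mpoly ratr)) (raddf_sum (meval _)). Qed.

Lemma peval_prod N (I : Type) (r : seq I) P (F : I -> Qpoly N) v :
  peval (\prod_(i <- r | P i) F i) v = \prod_(i <- r | P i) peval (F i) v.
Proof. by rewrite /peval (rmorph_prod (map_mpoly ratr)) (rmorph_prod (meval _)). Qed.

Lemma pevalZ N c (p : Qpoly N) v : peval (c *: p) v = ratr c * peval p v.
Proof. by rewrite /peval map_mpolyZ mevalZ. Qed.

Lemma pevalXn N (p : Qpoly N) n v : peval (p ^+ n) v = peval p v ^+ n.
Proof. by rewrite /peval !rmorphXn. Qed.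

(* The Segre embedding P^(N-1) x P^(M-1) -> P^(NM-1).                       *)
Definition segre N M (v : 'rV[algC]_N) (w : 'rV[algC]_M) : 'rV[algC]_(N * M) :=
  mxvec (v^T *m w).

Definition segre_image N M (X : set 'rV[algC]_N) (Y : set 'rV[algC]_M) :
    set 'rV[algC]_(N * M) :=
  [set z | exists v w, [/\ X v, Y w & z = segre v w]].

Lemma segreE N M (v : 'rV[algC]_N) (w : 'rV[algC]_M) i j :
  segre v w 0 (mxvec_index i j) = v 0 i * w 0 j.
Proof. by rewrite mxvecE mxE big_ord1 mxE. Qed.

Section SubstVars.
Variables (N K : nat) (h : 'I_N -> 'I_K).

Definition subst_vars (p : Qpoly N) : Qpoly K :=
  \sum_(m <- msupp p) p@_m *: \prod_i 'X_(h i) ^+ m i.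

Lemma peval_subst_vars p z :
  peval (subst_vars p) z = peval p (\row_i z 0 (h i)).
Proof.
rewrite peval_sum pevalE; apply: eq_bigr => m _; rewrite pevalZ peval_prod.
by congr (_ * _); apply: eq_bigr => i _; rewrite pevalXn pevalXU mxE.
Qed.

Lemma subst_vars_homog d p : p \is d.-homog -> subst_vars p \is d.-homog.
Proof.
move=> /dhomogP hp; rewrite /subst_vars big_seq; apply: rpred_sum => m /hp /= <-.
apply: rpredZ; rewrite mdegE.
elim/big_rec2: _ => [|i e q _ hq]; first exact: dhomog1.
apply: dhomogM => //; rewrite -[X in X.-homog]mul1n.
have hX : ('X_(h i) : Qpoly K) \is 1.-homog by rewrite dhomogX /= mdeg1.
exact: (dhomogMn (m i) hX).
Qed.
End SubstVars.

Section Product.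
Variables N M : nat.
Implicit Types (z : 'rV[algC]_(N * M)).
Local Notation ix := (@mxvec_index N M).

Definition segre_eqs : seq (Qpoly (N * M)) :=
  [seq 'X_(ix a.1 a.2) * 'X_(ix b.1 b.2) - 'X_(ix a.1 b.2) * 'X_(ix b.1 a.2)
     | a <- enum {: 'I_N * 'I_M}, b <- enum {: 'I_N * 'I_M}].

Lemma segre_eqs_homog p : p \in segre_eqs -> homogeneous p.
Proof.
move=> /allpairsP[[a b] /= [_ _ ->]]; exists 2%N.
by apply: rpredB; apply: (@dhomogM _ _ _ 1 _ 1); rewrite dhomogX; apply/eqP/mdeg1.
Qed.

Lemma segre_neq0 (v : 'rV[algC]_N) (w : 'rV[algC]_M) :
  v != 0 -> w != 0 -> segre v w != 0.
Proof.
move=> /rV0Pn[i vi] /rV0Pn[j wj]; apply/rV0Pn; exists (ix i j).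
by rewrite segreE mulf_neq0.
Qed.

Lemma segre_zeros : pzeros segre_eqs =
  segre_image [set v : 'rV[algC]_N | v != 0] [set w : 'rV[algC]_M | w != 0].
Proof.
apply/seteqP; split=> z /=; last first.
  move=> [v [w [v0 w0 ->]]]; split; first exact: segre_neq0.
  move=> _ /allpairsP[[a b] /= [_ _ ->]].
  by rewrite pevalB !pevalM !pevalXU !segreE mulrACA [X in _ - X]mulrACA
             [_ * w 0 a.2]mulrC subrr.
move=> [/rV0Pn[k zk] hz]; case/mxvec_indexP: k zk => i j zk.
exists (\row_i' z 0 (ix i' j)), ((z 0 (ix i j))^-1 *: \row_j' z 0 (ix i j')).
split.
- by apply/rV0Pn; exists i; rewrite mxE.
- by apply/rV0Pn; exists j; rewrite !mxE mulVf ?oner_eq0.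
apply/rowP => k; case/mxvec_indexP: k => a b; rewrite segreE !mxE.
apply: (mulIf zk); rewrite -mulrA [_^-1 * _]mulrC divfK //.
have := hz _ (allpairs_f _ (mem_enum _ (a, b)) (mem_enum _ (i, j))).
by rewrite /= pevalB !pevalM !pevalXU => /eqP; rewrite subr_eq0 => /eqP.
Qed.

Definition eqs_l (s : seq (Qpoly N)) : seq (Qpoly (N * M)) :=
  [seq subst_vars (ix^~ j) p | p <- s, j <- enum 'I_M].

Definition eqs_r (s : seq (Qpoly M)) : seq (Qpoly (N * M)) :=
  [seq subst_vars (ix i) p | p <- s, i <- enum 'I_N].

Lemma zclosed_eqs_l s :
  (forall p, p \in s -> homogeneous p) -> zclosed (pzeros (eqs_l s)).
Proof.
move=> hs; exists (eqs_l s) => // _ /allpairsP[[p j] /= [/hs[d hp] _ ->]].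
by exists d; apply: subst_vars_homog.
Qed.

Lemma zclosed_eqs_r s :
  (forall p, p \in s -> homogeneous p) -> zclosed (pzeros (eqs_r s)).
Proof.
move=> hs; exists (eqs_r s) => // _ /allpairsP[[p j] /= [/hs[d hp] _ ->]].
by exists d; apply: subst_vars_homog.
Qed.

Lemma eqs_lP s (v : 'rV[algC]_N) (w : 'rV[algC]_M) :
    (forall p, p \in s -> homogeneous p) -> v != 0 -> w != 0 ->
  pzeros (eqs_l s) (segre v w) <-> pzeros s v.
Proof.
move=> hs v0 w0; have ev p d (j : 'I_M) : p \is d.-homog ->
  peval (subst_vars (ix^~ j) p) (segre v w) = w 0 j ^+ d * peval p v.
  move=> hp; rewrite peval_subst_vars -(peval_scale _ _ hp); congr peval.
  by apply/rowP => i; rewrite !mxE segreE mulrC.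
split=> -[_ h]; last first.
  split=> [|_ /allpairsP[[p j] /= [sp _ ->]]]; first by rewrite segre_neq0.
  by have [d hp] := hs p sp; rewrite (ev _ _ _ hp) h ?mulr0.
split=> // p sp; have [d hp] := hs p sp; have /rV0Pn[j wj] := w0.
have /eqP := h _ (allpairs_f _ sp (mem_enum _ j)).
by rewrite /= (ev _ _ _ hp) mulf_eq0 expf_eq0 (negPf wj) andbF => /eqP.
Qed.

Lemma eqs_rP s (v : 'rV[algC]_N) (w : 'rV[algC]_M) :
    (forall p, p \in s -> homogeneous p) -> v != 0 -> w != 0 ->
  pzeros (eqs_r s) (segre v w) <-> pzeros s w.
Proof.
move=> hs v0 w0; have ev p d (i : 'I_N) : p \is d.-homog ->
  peval (subst_vars (ix i) p) (segre v w) = v 0 i ^+ d * peval p w.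
  move=> hp; rewrite peval_subst_vars -(peval_scale _ _ hp); congr peval.
  by apply/rowP => j; rewrite !mxE segreE.
split=> -[_ h]; last first.
  split=> [|_ /allpairsP[[p j] /= [sp _ ->]]]; first by rewrite segre_neq0.
  by have [d hp] := hs p sp; rewrite (ev _ _ _ hp) h ?mulr0.
split=> // p sp; have [d hp] := hs p sp; have /rV0Pn[j wj] := v0.
have /eqP := h _ (allpairs_f _ sp (mem_enum _ j)).
by rewrite /= (ev _ _ _ hp) mulf_eq0 expf_eq0 (negPf wj) andbF => /eqP.
Qed.

Lemma segre_image_lc (X : qpvar N) (Y : qpvar M) :
  exists A B, [/\ zclosed A, zclosed B & segre_image X Y = A `\` B].
Proof.
case: (pts_lc X) => _ [_ [[a ha ->] [b hb ->] eX]].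
case: (pts_lc Y) => _ [_ [[c hc ->] [d hd ->] eY]].
exists (pzeros segre_eqs `&` (pzeros (eqs_l a) `&` pzeros (eqs_r c))).
exists (pzeros (eqs_l b) `|` pzeros (eqs_r d)); split.
- apply: zclosedI; first by exists segre_eqs => //; apply: segre_eqs_homog.
  by apply: zclosedI; [apply: zclosed_eqs_l | apply: zclosed_eqs_r].
- by apply: zclosedU; [apply: zclosed_eqs_l | apply: zclosed_eqs_r].
rewrite segre_zeros eX eY; apply/seteqP; split=> z /=.
  move=> [v [w [[va vb] [wc wd] ->]]].
  have [[v0 _] [w0 _]] := (va, wc).
  split; first by split; [exists v, w | split; [apply/eqs_lP | apply/eqs_rP]].
  by case=> [/(eqs_lP hb v0 w0)|/(eqs_rP hd v0 w0)].
move=> [[[v [w [v0 w0 ->]]] [/(eqs_lP ha v0 w0) va /(eqs_rP hc v0 w0) wc]] nbd].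
exists v, w; split=> //; split=> // h; apply: nbd.
  by left; apply/eqs_lP.
by right; apply/eqs_rP.
Qed.

Definition prodv (X : qpvar N) (Y : qpvar M) : qpvar (N * M) :=
  QPVar (segre_image_lc X Y).
End Product.

Lemma projspace_lc N : exists A B,
  [/\ zclosed A, zclosed B & [set v : 'rV[algC]_N | v != 0] = A `\` B].
Proof.
exists [set v | v != 0], (pzeros [:: 1]); split; first exact: zclosed_all.
  by apply: zclosed_pzeros1; exists 0%N; apply: dhomog1.
apply/seteqP; split=> v /= => [v0|[]//]; split=> // -[_ /(_ 1 (mem_head _ _))].
by rewrite /peval !rmorph1 => /eqP; rewrite oner_eq0.
Qed.

Definition projspace k : qpvar k.+1 := QPVar (projspace_lc k.+1).

Definition point : qpvar 1 := projspace 0.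

Lemma irreducible_point : irreducible point.
Proof.
have e1 (v : 'rV[algC]_1) : v = v 0 0 *: 1.
  by apply/rowP => i; rewrite !ord1 !mxE mulr1.
have unit1 (v : 'rV[algC]_1) : v != 0 -> v 0 0 != 0.
  by apply: contra_neq => h; rewrite (e1 v) h scale0r.
split; first by exists 1; rewrite /= oner_eq0.
move=> A B hA hB hAB.
by case: (hAB 1 (oner_neq0 _)) => h; [left|right] => v /unit1 v0;
   rewrite (e1 v); apply: zclosed_scale.
Qed.

(* A^n is the chart v_0 != 0 of P^n.                                        *)
Definition affine_coord n (v : 'rV[algC]_n.+1) : 'rV[algC]_n :=
  \row_i (v 0 (lift ord0 i) / v 0 0).

Definition affine_compl_pts n (p : Qpoly n) : set 'rV[algC]_n.+1 :=
  [set v : 'rV[algC]_n.+1 | v 0 0 != 0 /\ peval p (affine_coord v) != 0].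

Definition homogenize n (p : Qpoly n) : Qpoly n.+1 :=
  \sum_(m <- msupp p)
     p@_m *: ('X_ord0 ^+ (msize p - mdeg m) * \prod_i 'X_(lift ord0 i) ^+ m i).

Lemma homogeneous_homogenize n (p : Qpoly n) : homogeneous (homogenize p).
Proof.
have hX i k : ('X_i : Qpoly n.+1) ^+ k \is k.-homog.
  rewrite -[X in X.-homog]mul1n.
  have h1 : ('X_i : Qpoly n.+1) \is 1.-homog by rewrite dhomogX /= mdeg1.
  exact: (dhomogMn k h1).
have hm (m : 'X_{1..n}) :
  (\prod_i 'X_(lift ord0 i) ^+ m i : Qpoly n.+1) \is (mdeg m).-homog.
  rewrite mdegE; elim/big_rec2: _ => [|i e q _ hq]; first exact: dhomog1.
  exact: dhomogM.
exists (msize p); rewrite /homogenize big_seq; apply: rpred_sum => m pm.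
apply: rpredZ; have := dhomogM (hX ord0 (msize p - mdeg m)%N) (hm m).
by rewrite subnK //; apply/ltnW/msize_mdeg_lt.
Qed.

Lemma peval_homogenize n (p : Qpoly n) (v : 'rV[algC]_n.+1) : v 0 0 != 0 ->
  peval (homogenize p) v = v 0 0 ^+ msize p * peval p (affine_coord v).
Proof.
move=> v0; rewrite peval_sum pevalE big_distrr /= !big_seq.
apply: eq_bigr => m hm; rewrite pevalZ pevalM pevalXn pevalXU peval_prod.
rewrite [RHS]mulrCA; congr (_ * _).
rewrite -[in RHS](@subnK (mdeg m) (msize p)); last exact/ltnW/msize_mdeg_lt.
rewrite exprD -mulrA; congr (_ * _); rewrite mdegE -prodrXr -big_split /=.
by apply: eq_bigr => i _; rewrite pevalXn pevalXU mxE exprMn exprVn mulrC divfK ?expf_neq0.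
Qed.

Lemma affine_compl_lc n (p : Qpoly n) : exists A B,
  [/\ zclosed A, zclosed B & affine_compl_pts p = A `\` B].
Proof.
exists [set v | v != 0], (pzeros [:: 'X_ord0 * homogenize p]); split.
- exact: zclosed_all.
- apply/zclosed_pzeros1/homogeneousM; first exact: homogeneousXU.
  exact: homogeneous_homogenize.
apply/seteqP; split=> v /=.
  move=> [v0 pv]; split; first by apply/rV0Pn; exists 0.
  move=> [_ /(_ _ (mem_head _ _))]; rewrite pevalM pevalXU peval_homogenize //.
  by move/eqP; rewrite !mulf_eq0 expf_eq0 (negPf v0) (negPf pv) andbF.
move=> [v0 h]; have [e|e] := eqVneq (v 0 0) 0.
  case: h; split=> // q; rewrite inE => /eqP ->.
  by rewrite pevalM pevalXU e mul0r.
split=> //; apply/eqP => pv; case: h; split=> // q; rewrite inE => /eqP ->.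
by rewrite pevalM peval_homogenize // pv !mulr0.
Qed.

Definition affine_compl n (p : Qpoly n) : qpvar n.+1 := QPVar (affine_compl_lc p).

HB.instance Definition _ N := gen_eqMixin (qpvar N).
HB.instance Definition _ N := gen_choiceMixin (qpvar N).

Definition variety := {N : nat & qpvar N}.

(* K(Var) is presented as a commutative ring: the free one on the varieties *)
(* modulo the ideal generated by the relators below. The last of these      *)
(* makes the class of a point, which is a unit for the product of           *)
(* varieties, equal to 1.                                                   *)
Definition KFree : comNzRingType := {malg int[{cmonom variety}]}.

Definition kgen N (X : qpvar N) : KFree :=
  << ucm (existT qpvar N X : variety) >>.

Inductive krel : KFree -> Prop :=
| krel_iso N M (X : qpvar N) (Y : qpvar M) :
    isomorphic X Y -> krel (kgen X - kgen Y)
| krel_scissor N (X Y U : qpvar N) :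
    closed_in Y X -> pts U = X `\` Y -> krel (kgen X - (kgen U + kgen Y))
| krel_prod N M (X : qpvar N) (Y : qpvar M) :
    krel (kgen X * kgen Y - kgen (prodv X Y))
| krel_point : krel (kgen point - 1).

Definition kideal_prop (x : KFree) : Prop :=
  exists2 s : seq (KFree * KFree), (forall c, c \in s -> krel c.2)
                                 & x = \sum_(c <- s) c.1 * c.2.

Definition kideal : {pred KFree} := fun x => `[< kideal_prop x >].

Lemma kidealP x : reflect (kideal_prop x) (x \in kideal).
Proof. exact: asboolP. Qed.

Lemma kideal_rel x : krel x -> x \in kideal.
Proof.
move=> hx; apply/kidealP; exists [:: (1, x)]; last by rewrite big_seq1 mul1r.
by move=> c; rewrite inE => /eqP ->.
Qed.

Lemma kidealMr a x : x \in kideal -> a * x \in kideal.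
Proof.
move=> /kidealP[s hs ->]; apply/kidealP; exists [seq (a * c.1, c.2) | c <- s].
  by move=> _ /mapP[c /hs hc ->].
by rewrite big_map big_distrr /=; apply: eq_bigr => c _; rewrite mulrA.
Qed.

Lemma kideal_zmod_closed : zmod_closed kideal.
Proof.
split=> [|x y /kidealP[s hs ->] /(kidealMr (-1)) /kidealP[t ht et]].
  by apply/kidealP; exists [::]; rewrite ?big_nil.
apply/kidealP; exists (s ++ t); first by move=> c; rewrite mem_cat => /orP[/hs|/ht].
by rewrite big_cat /= -et mulN1r.
Qed.

HB.instance Definition _ := GRing.isZmodClosed.Build KFree kideal kideal_zmod_closed.

Definition KVar := Quotient.quot kideal.
HB.instance Definition _ := GRing.Zmodule.on KVar.

Definition kpi (x : KFree) : KVar := \pi_KVar x.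

Lemma kpi_eq x y : kpi x = kpi y <-> x - y \in kideal.
Proof.
by rewrite /kpi Quotient.idealrBE; split=> [->|/eqP].
Qed.

Definition kone : KVar := kpi 1.
Definition kmul (x y : KVar) : KVar := kpi (repr x * repr y).

Lemma kreprK x : kpi (repr x) = x.
Proof. exact: reprK. Qed.

Lemma kpiD x y : kpi (x + y) = kpi x + kpi y.
Proof. exact: (Quotient.pi_add kideal x y). Qed.

Lemma kpiM x y : kpi (x * y) = kmul (kpi x) (kpi y).
Proof.
have hr z : z - repr (kpi z) \in kideal by apply/kpi_eq; rewrite kreprK.
apply/kpi_eq.
rewrite (_ : _ - _ = y * (x - repr (kpi x)) + repr (kpi x) * (y - repr (kpi y))).
  by rewrite rpredD ?kidealMr.
by rewrite !mulrBr addrA [y * x]mulrC [y * _]mulrC subrK.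
Qed.

Fact kmulA : associative kmul.
Proof.
move=> x y z; rewrite -[x]kreprK -[y]kreprK -[z]kreprK.
by rewrite -!kpiM mulrA.
Qed.

Fact kmulC : commutative kmul.
Proof. by move=> x y; rewrite /kmul mulrC. Qed.

Fact kmul1 : left_id kone kmul.
Proof. by move=> x; rewrite -[x]kreprK -kpiM mul1r. Qed.

Fact kmulDl : left_distributive kmul +%R.
Proof.
move=> x y z; rewrite -[x]kreprK -[y]kreprK -[z]kreprK.
by rewrite -kpiD -!kpiM mulrDl kpiD.
Qed.

HB.instance Definition _ :=
  GRing.Zmodule_isComPzRing.Build KVar kmulA kmulC kmul1 kmulDl.

Definition kclass N (X : qpvar N) : KVar := kpi (kgen X).

Lemma kpi_rel x y : krel (x - y) -> kpi x = kpi y.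
Proof. by move=> h; apply/kpi_eq/kideal_rel. Qed.

Lemma kclass_iso N M (X : qpvar N) (Y : qpvar M) :
  isomorphic X Y -> kclass X = kclass Y.
Proof. by move=> h; apply/kpi_rel/krel_iso. Qed.

Lemma kclass_scissor N (X Y U : qpvar N) :
  closed_in Y X -> pts U = X `\` Y -> kclass X = kclass U + kclass Y.
Proof. by move=> hY hU; rewrite -kpiD; apply/kpi_rel/krel_scissor. Qed.

Lemma kclass_prod N M (X : qpvar N) (Y : qpvar M) :
  kclass (prodv X Y) = kclass X * kclass Y.
Proof. by rewrite -[RHS]kpiM; apply/esym/kpi_rel/krel_prod. Qed.

Lemma kclass_point : kclass point = 1.
Proof. exact/kpi_rel/krel_point. Qed.

Record irrvar N := IrrVar { irr_var :> qpvar N; irr_varP : irreducible irr_var }.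

HB.instance Definition _ N := gen_eqMixin (irrvar N).
HB.instance Definition _ N := gen_choiceMixin (irrvar N).

Definition irrvariety := {N : nat & irrvar N}.

(* The nonempty open subsets of an irreducible variety are the dense ones.  *)
Definition birational N M (X : qpvar N) (Y : qpvar M) : Prop :=
  exists (U : qpvar N) (V : qpvar M),
    [/\ open_in U X, U !=set0, open_in V Y, V !=set0 & isomorphic U V].

Definition stably_birational N M (X : qpvar N) (Y : qpvar M) : Prop :=
  exists k l, birational (prodv X (projspace k)) (prodv Y (projspace l)).

Definition sb_rel (x y : irrvariety) : Prop :=
  stably_birational (projT2 x) (projT2 y).

(* The quotient is taken by the equivalence relation generated by sb_rel,   *)
(* which is sb_rel itself.                                                  *)
Definition sb_eqv (x y : irrvariety) : bool := `[< clos_refl_sym_trans _ sb_rel x y >].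

Fact sb_eqv_equiv : equiv_class_of sb_eqv.
Proof.
split=> [x|x y|y x z].
- exact/asboolP/rst_refl.
- by apply/asboolP/asboolP; apply: rst_sym.
- by move=> /asboolP xy /asboolP yz; apply/asboolP/(rst_trans _ _ _ _ _ xy yz).
Qed.

Canonical sb_eqv_equivRel := EquivRelPack sb_eqv_equiv.
Canonical sb_eqv_encModRel := defaultEncModRel sb_eqv.

Definition SB := {eq_quot sb_eqv}.
HB.instance Definition _ := Choice.on SB.

Definition sb_class N (X : irrvar N) : SB :=
  \pi_SB (existT irrvar N X : irrvariety).

Lemma sb_class_eq N M (X : irrvar N) (Y : irrvar M) :
  stably_birational X Y -> sb_class X = sb_class Y.
Proof. by move=> h; apply/eqmodP/asboolP/rst_step. Qed.

Definition ZSB := {malg int[SB]}.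
HB.instance Definition _ := GRing.Zmodule.on ZSB.

Definition zsb_class N (X : irrvar N) : ZSB := << sb_class X >>.

Definition is_components N (X : qpvar N) (s : seq (irrvar N)) : Prop :=
  uniq s /\ forall Z : irrvar N, Z \in s <->
    closed_in Z X /\ forall W : irrvar N, closed_in W X -> Z `<=` W -> W `<=` Z.

Definition components N (X : qpvar N) : seq (irrvar N) :=
  xget [::] [set s | is_components X s].

(* Over Q, the product of two irreducible varieties need not be irreducible: *)
(* the product of their classes is the sum of the classes of its            *)
(* irreducible components, which is the class of the product whenever the   *)
(* latter is irreducible. It does not depend on the representatives.        *)
Definition sb_prod (s t : SB) : ZSB :=
  \sum_(Z <- components (prodv (projT2 (repr s)) (projT2 (repr t)))) zsb_class Z.

Definition zsb_mul (a b : ZSB) : ZSB :=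
  \sum_(s <- monalg.msupp a) \sum_(t <- monalg.msupp b)
    sb_prod s t *~ (monalg.mcoeff s a * monalg.mcoeff t b).

Definition zsb_one : ZSB := zsb_class (IrrVar irreducible_point).

Definition larsen_lunts (phi : KVar -> ZSB) : Prop :=
  [/\ {morph phi : x y / x + y},
      {morph phi : x y / x * y >-> zsb_mul x y},
      phi 1 = zsb_one &
      forall N (V : irrvar N), zclosed V -> smooth V ->
        phi (kclass V) = zsb_class V].

(* An edge e is a loop if gends e = (u, u); its orientation is irrelevant.  *)
Record graph := Graph {
  gvert : finType;
  gsize : nat;
  gends : 'I_gsize -> gvert * gvert
}.

Section GraphPolynomial.
Variable G : graph.
Local Notation V := (gvert G).
Local Notation E := 'I_(gsize G).

Definition adj (T : {set E}) : rel V := fun u v =>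
  [exists e in T, (gends e == (u, v)) || (gends e == (v, u))].

Definition edges_in (C : {set V}) : {set E} :=
  finset (fun e => ((gends e).1 \in C) && ((gends e).2 \in C)).

(* An edge lies on a cycle iff its ends remain connected without it.        *)
Definition acyclic (T : {set E}) : bool :=
  [forall e in T, ~~ connect (adj (T :\ e))
                             (gends e).1 (gends e).2].

Definition spanning_tree (C : {set V}) (T : {set E}) : bool :=
  [&& T \subset edges_in C,
      [forall u in C, forall v in C, connect (adj T) u v] & acyclic T].

Definition conn_components : {set {set V}} :=
  equivalence_partition (connect (adj (finset.setTfor E))) (finset.setTfor V).

Definition component_poly (C : {set V}) : Qpoly (gsize G) :=
  \sum_(T : {set E} | spanning_tree C T)
     \prod_(e in edges_in C :\: T) 'X_e.

Definition graph_poly : Qpoly (gsize G) :=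
  \prod_(C in conn_components) component_poly C.

Definition graph_compl : qpvar (gsize G).+1 := affine_compl graph_poly.
End GraphPolynomial.

(* The additive span of the classes [Y_G]; it is a subring because the      *)
(* product of [Y_G1] and [Y_G2] is the class of the disjoint union.         *)
Definition graph_ring : set KVar :=
  [set x | exists s : seq (int * graph),
             x = \sum_(c <- s) kclass (graph_compl c.2) *~ c.1].

(* Main.v *)
(* Every variable occurs with degree at most 1 in a graph polynomial, and     *)
(* this alone forces the image of [Y_G] into Z. The projective line is stably *)
(* birational to a point, so phi kills the affine line L and hence every      *)
(* cylinder. If p = x f1 + f0 with f1, f0 free of x, then {p != 0} and        *)
(* {f1 != 0} share the open subset {p != 0, f1 != 0}; the remainder of the    *)
(* first, {f1 = 0, f0 != 0}, and the whole of the second are cylinders in     *)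
(* the direction of x, while the remainder of the second is the graph of      *)
(* x = - f0 / f1 over {f1 != 0, x = 0}. Hence phi [p != 0] is the opposite    *)
(* of phi [f1 != 0, x = 0]; iterating, phi [Y_G] is 0 or a sign. The graph    *)
(* without vertices gives 1.                                                  *)
Require Import Defs.
From mathcomp Require Import all_boot all_order all_algebra all_field.
From mathcomp Require Import boolp classical_sets.
From mathcomp Require Import monalg mpoly.
From mathcomp Require Import ring.
Import Order.TTheory GRing.Theory Num.Theory.
Local Open Scope ring_scope.
Local Open Scope classical_set_scope.

Set Implicit Arguments.
Unset Strict Implicit.
Unset Printing Implicit Defensive.

(** In a term of a component polynomial each edge variable occurs at most once, and an edge lies in
    at most one component, so graph polynomials are multi-affine ([graph_poly_degs_le]). On the
    geometric side P^1 is smooth, projective and stably birational to a point, so the decomposition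
    of P^1 into A^1 and a point forces [phi] to kill A^1 ([larsen_lunts_affine_line]), hence every
    product A^1 x Z ([larsen_lunts_cylinder]). For p = x f1 + f0 this eliminates x at the cost of a
    sign ([larsen_lunts_slice]). Induction on the number of remaining variables ends at a constant,
    whose complement is empty or a point ([larsen_lunts_multiaffine]). Conversely, the empty graph
    has the class of a point, and its multiples fill Z. *)

(** * Degree bounds in each variable *)

(** Taking for [h] the indicator of a set [S] says two things at once: the polynomial is
    multi-affine, and it involves only the variables in [S]. *)
Definition degs_le n (h : 'I_n -> nat) (p : Qpoly n) : Prop :=
  forall m, m \in msupp p -> forall i, (m i <= h i)%N.

Section DegsLe.
Context {n : nat}.
Implicit Types (h : 'I_n -> nat) (p q : Qpoly n).

Lemma degs_le1 h : degs_le h 1.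
Proof. by move=> m; rewrite msupp1 inE => /eqP-> i; rewrite mnm0E. Qed.

Lemma degs_leX h (m : 'X_{1..n}) : (forall i, (m i <= h i)%N) -> degs_le h 'X_[m].
Proof. by move=> hm m'; rewrite msuppX inE => /eqP->. Qed.

Lemma degs_leZ h c p : degs_le h p -> degs_le h (c *: p).
Proof. by move=> hp m /msuppZ_le /hp. Qed.

Lemma degs_le_sum h (I : eqType) (r : seq I) (P : pred I) (F : I -> Qpoly n) :
  (forall i, i \in r -> P i -> degs_le h (F i)) ->
  degs_le h (\sum_(i <- r | P i) F i).
Proof.
move=> hF m /msupp_sum_le /flattenP[_ /mapP[i + ->]].
by rewrite mem_filter => /andP[Pi ri] /(hF i ri Pi).
Qed.

Lemma degs_leM h h' p q :
  degs_le h p -> degs_le h' q -> degs_le (fun i => h i + h' i)%N (p * q).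
Proof.
move=> hp hq _ /msuppM_le /allpairsP[[a b] /= [pa qb ->]] i.
by rewrite mnmDE leq_add ?hp ?hq.
Qed.

Lemma degs_le_prod (I : Type) (r : seq I) (P : pred I) (h : I -> 'I_n -> nat)
    (F : I -> Qpoly n) :
  (forall i, P i -> degs_le (h i) (F i)) ->
  degs_le (fun j => \sum_(i <- r | P i) h i j)%N (\prod_(i <- r | P i) F i).
Proof.
move=> hF; elim: r => [|i r IH].
  by rewrite big_nil; apply: degs_le1.
rewrite big_cons; case: ifP => Pi m hm j; rewrite big_cons Pi; last exact: IH.
exact: (degs_leM (hF i Pi) IH).
Qed.

Lemma degs_leW h h' p :
  (forall i, (h i <= h' i)%N) -> degs_le h p -> degs_le h' p.
Proof. by move=> hh hp m pm i; apply: leq_trans (hh i); apply: hp. Qed.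

Lemma degs_le_const p : degs_le (fun=> 0%N) p -> p = p@_0%MM *: 1.
Proof.
move=> hp; apply/mpolyP => m; rewrite mcoeffZ mcoeff1.
have [<-|m0] := eqVneq; first by rewrite mulr1.
rewrite mulr0; apply: memN_msupp_eq0; apply: contra m0 => /hp pm.
by apply/eqP/mnmP => i; have := pm i; rewrite mnm0E; case: (m i).
Qed.

(** Monomials are sorted by whether 'X_e divides them. Those it divides contain it exactly once, so
    the quotients are free of it. *)
Lemma degs_le_split (S : {set 'I_n}) e p :
    e \in S -> degs_le (fun i => i \in S) p ->
  exists f1 f0, [/\ p = 'X_e * f1 + f0, degs_le (fun i => i \in S :\ e) f1
                  & degs_le (fun i => i \in S :\ e) f0].
Proof.
move=> eS hp.
exists (\sum_(m <- msupp p | m e != 0%N) p@_m *: 'X_[m - U_(e)]).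
exists (\sum_(m <- msupp p | m e == 0%N) p@_m *: 'X_[m]).
split.
- rewrite {1}[p]mpolyE (bigID (fun m : 'X_{1..n} => m e != 0%N)) /=.
  congr (_ + _); last by apply: eq_bigl => m; rewrite negbK.
  rewrite big_distrr /=; apply: eq_bigr => m me.
  by rewrite -scalerAr -mpolyXD addmC submK // lep1mP.
- apply: degs_le_sum => m /hp pm me; apply/degs_leZ/degs_leX => i.
  have := pm i; rewrite mnmBE mnm1E !inE [i == e]eq_sym.
  by case: eqP => [<-|_]; rewrite ?subn0 // eS leq_subLR.
- apply: degs_le_sum => m /hp pm /eqP me; apply/degs_leZ/degs_leX => i.
  by have := pm i; rewrite !inE; case: eqP => [->|_] //; rewrite me.
Qed.
End DegsLe.

Lemma graph_poly_degs_le (G : graph) : degs_le (fun=> 1%N) (graph_poly G).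
Proof.
have comp_le (C : {set gvert G}) :
    degs_le (fun e => e \in edges_in C) (component_poly C).
  apply: degs_le_sum => T _ _; apply: degs_leW; last first.
    apply: (@degs_le_prod _ _ _ _ (fun e i => (e == i) : nat)) => e _.
    by apply: degs_leX => i; rewrite mnm1E.
  move=> i /=; rewrite big_mkcond (bigD1 i) //= big1 => [|j /negPf ->]; last first.
    by case: ifP.
  by rewrite eqxx addn0; case: ifP => // /setDP[->].
apply: degs_leW; last by apply: degs_le_prod => C _; apply: comp_le.
(* Connectedness is an equivalence relation, so distinct components are disjoint. *)
have tr : finset.trivIset (conn_components G).
  have adj_sym : ssrbool.symmetric (adj (finset.setTfor 'I_(gsize G))).
    by move=> u v; apply: eq_existsb => e; rewrite orbC.
  apply/partition_trivIset/equivalence_partitionP => x y z _ _ _.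
  split=> [|xy]; first exact: connect0.
  by apply/idP/idP; apply: connect_trans => //; rewrite (sym_connect_sym adj_sym).
move=> e /=; set v := (gends e).1.
(* Only the component of the first end [v] of [e] can contain [e], so the total exponent is at most
   1. *)
suff : (\sum_(C in conn_components G) (e \in edges_in C) <=
        \sum_(C in conn_components G) (C == finset.pblock (conn_components G) v))%N.
  move=> /leq_trans; apply.
  rewrite big_mkcond (bigD1 (finset.pblock (conn_components G) v)) //= big1.
    by case: ifP; rewrite ?eqxx.
  by move=> C /negPf ->; case: ifP.
apply: leq_sum => C CG; rewrite inE -/v.
by case: (boolP (v \in C)) => //= vC; rewrite (def_pblock tr CG vC) eqxx leq_b1.
Qed.

(** * Polynomial isomorphisms and scissor relations *)

Lemma morphism_polymap N M d (X : qpvar N) (Y : qpvar M) (F : 'I_M -> Qpoly N) :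
    (forall i, F i \is d.-homog) -> (forall v, pts X v -> pts Y (polymap F v)) ->
  morphism X Y (polymap F).
Proof.
move=> hF hXY; split=> // x Xx; exists d, F; split=> //.
  exact/qpvar_neq0/hXY.
by move=> y _ _; exists 1; rewrite ?oner_neq0 ?scale1r.
Qed.

Lemma isomorphic_polymap N M d e (X : qpvar N) (Y : qpvar M)
    (F : 'I_M -> Qpoly N) (G : 'I_N -> Qpoly M) :
    (forall i, F i \is d.-homog) -> (forall i, G i \is e.-homog) ->
    (forall v, pts X v -> pts Y (polymap F v)) -> (forall w, pts Y w -> pts X (polymap G w)) ->
    (forall v, pts X v -> proj_eq (polymap G (polymap F v)) v) ->
    (forall w, pts Y w -> proj_eq (polymap F (polymap G w)) w) ->
  isomorphic X Y.
Proof.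
move=> hF hG XY YX GF FG; exists (polymap F), (polymap G).
by split=> //; [apply: morphism_polymap hF XY | apply: morphism_polymap hG YX].
Qed.

Lemma peval0 N (v : 'rV[algC]_N) : peval 0 v = 0.
Proof. by rewrite /peval !rmorph0. Qed.

Lemma peval1 N (v : 'rV[algC]_N) : peval 1 v = 1.
Proof. by rewrite /peval !rmorph1. Qed.

Lemma dhomogXU N (i : 'I_N) : ('X_i : Qpoly N) \is 1.-homog.
Proof. by rewrite dhomogX /= mdeg1. Qed.

Lemma dhomogXUn N (i : 'I_N) k : ('X_i ^+ k : Qpoly N) \is k.-homog.
Proof. by rewrite -[X in X.-homog]mul1n; apply/dhomogMn/dhomogXU. Qed.

Lemma homogenize_dhomog n (p : Qpoly n) : homogenize p \is (msize p).-homog.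
Proof.
rewrite /homogenize big_seq; apply: rpred_sum => m pm; apply: rpredZ.
rewrite -(@subnK (mdeg m) (msize p)); last exact/ltnW/msize_mdeg_lt.
rewrite addnK; apply: dhomogM; first exact: dhomogXUn.
rewrite mdegE; elim/big_rec2: _ => [|i e q _]; first exact: dhomog1.
by apply: dhomogM; apply: dhomogXUn.
Qed.

Lemma ex_qpvar_setI N (X : qpvar N) A :
  zclosed A -> exists Z : qpvar N, Z = X `&` A :> set _.
Proof.
move=> hA; case: (pts_lc X) => B [C [hB hC eX]].
have h : exists B' C', [/\ zclosed B', zclosed C' & X `&` A = B' `\` C'].
  by exists (B `&` A), C; rewrite eX setIDAC setIDA; split=> //; apply: zclosedI.
by exists (QPVar h).
Qed.

Lemma ex_qpvar_setD N (X : qpvar N) A :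
  zclosed A -> exists U : qpvar N, U = X `\` A :> set _.
Proof.
move=> hA; case: (pts_lc X) => B [C [hB hC eX]].
have h : exists B' C', [/\ zclosed B', zclosed C' & X `\` A = B' `\` C'].
  by exists B, (C `|` A); rewrite eX setDDl; split=> //; apply: zclosedU.
by exists (QPVar h).
Qed.

Lemma kclass_split N (X Z U : qpvar N) A :
  zclosed A -> Z = X `&` A :> set _ -> U = X `\` A :> set _ ->
  kclass X = kclass U + kclass Z.
Proof.
move=> hA hZ hU; apply: kclass_scissor; first by exists A.
by rewrite hU hZ setDIr setDv set0U.
Qed.

(** Cutting the empty set leaves two empty pieces, so its class equals its own double. *)
Lemma kclass_set0 N (X : qpvar N) : X = set0 :> set _ -> kclass X = 0.
Proof.
move=> X0; have h : kclass X = kclass X + kclass X.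
  apply: kclass_split (@zclosed_all N) _ _; first by rewrite X0 set0I.
  by rewrite X0 set0D.
by apply: (addrI (kclass X)); rewrite addr0.
Qed.

Lemma isomorphic_coord_point N (X : qpvar N) (k : 'I_N) :
    (forall v, pts X v <-> v 0 k != 0 /\ forall i, i != k -> v 0 i = 0) ->
  isomorphic X Defs.point.
Proof.
move=> hX.
apply: (@isomorphic_polymap _ _ 1 1 _ _ (fun=> 'X_k)
          (fun i => if i == k then 'X_ord0 else 0)).
- by move=> _; apply: dhomogXU.
- by move=> i; case: ifP => _; [apply: dhomogXU | apply: rpred0].
- by move=> v /hX[vk _]; apply/rV0Pn; exists ord0; rewrite mxE pevalXU.
- move=> w /rV0Pn[j]; rewrite ord1 => w0; apply/hX.
  split=> [|i /negPf ik]; rewrite mxE ?eqxx ?pevalXU //.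
  by rewrite ik peval0.
- move=> v /hX[vk vi]; exists 1; rewrite ?oner_neq0 // scale1r.
  apply/rowP => i; rewrite mxE; case: eqP => [->|/eqP /vi ->]; last by rewrite peval0.
  by rewrite pevalXU mxE pevalXU.
- move=> w _; exists 1; rewrite ?oner_neq0 // scale1r.
  by apply/rowP => i; rewrite mxE pevalXU mxE eqxx pevalXU !ord1.
Qed.

(** In Segre coordinates, exchanging the factors is the transposition of a matrix, hence linear. *)
Lemma isomorphic_prodvC N M (X : qpvar N) (Y : qpvar M) :
  isomorphic (Defs.prodv X Y) (Defs.prodv Y X).
Proof.
pose swap A B (k : 'I_(B * A)) : Qpoly (A * B) :=
  mxvec (\matrix_(j < B, i < A) 'X_(mxvec_index i j)) 0 k.
have swap_homog A B k : @swap A B k \is 1.-homog.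
  by case/mxvec_indexP: k => i j; rewrite /swap mxvecE mxE; apply: dhomogXU.
have swapE A B (v : 'rV_A) (w : 'rV_B) : polymap (@swap A B) (segre v w) = segre w v.
  apply/rowP => k; case/mxvec_indexP: k => j i.
  by rewrite mxE /swap mxvecE mxE pevalXU !segreE mulrC.
apply: (@isomorphic_polymap _ _ 1 1 _ _ (@swap N M) (@swap M N)) => //.
- by move=> _ [v [w [Xv Yw ->]]]; exists w, v; rewrite swapE.
- by move=> _ [w [v [Yw Xv ->]]]; exists v, w; rewrite swapE.
- by move=> _ [v [w [Xv Yw ->]]]; exists 1; rewrite ?oner_neq0 // !swapE scale1r.
- by move=> _ [v [w [Xv Yw ->]]]; exists 1; rewrite ?oner_neq0 // !swapE scale1r.
Qed.

(** * Cylinders in the direction of a coordinate *)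

Definition set_coord N (k : 'I_N) (c : algC) (v : 'rV[algC]_N) : 'rV[algC]_N :=
  \row_i if i == k then c else v 0 i.

Lemma set_coord_id N (k : 'I_N) (v : 'rV[algC]_N) : set_coord k (v 0 k) v = v.
Proof. by apply/rowP => i; rewrite mxE; case: eqP => // ->. Qed.

Lemma set_coordK N (k : 'I_N) b c v :
  set_coord k c (set_coord k b v) = set_coord k c v.
Proof. by apply/rowP => i; rewrite !mxE; case: eqP. Qed.

Lemma set_coordZ N (k : 'I_N) a c v :
  set_coord k (a * c) (a *: v) = a *: set_coord k c v.
Proof. by apply/rowP => i; rewrite !mxE; case: eqP. Qed.

Definition affine_line : qpvar 2 := affine_compl 1.

Lemma affine_lineE v : pts affine_line v <-> v 0 0 != 0.
Proof. by split=> [[]|v0] //; split; rewrite ?peval1 ?oner_neq0. Qed.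

Lemma isomorphic_cylinder n (X Z : qpvar n.+1) (k : 'I_n.+1) :
    k != ord0 -> (forall v, pts X v -> v 0 0 != 0) ->
    (forall c v, pts X v -> pts X (set_coord k c v)) ->
    (forall v, pts Z v <-> pts X v /\ v 0 k = 0) ->
  isomorphic (Defs.prodv affine_line Z) X.
Proof.
move=> k0 X0 Xk hZ.
(* The pair of (a_0 : a_1) and v goes to the point with coordinates a_0 v_i, except a_1 v_0 at
   position [k]: the affine coordinate there becomes a_1 / a_0. *)
pose F (i : 'I_n.+1) : Qpoly (2 * n.+1) :=
  if i == k then 'X_(mxvec_index (1 : 'I_2) (0 : 'I_n.+1))
  else 'X_(mxvec_index (0 : 'I_2) i).
(* The inverse sends w to the Segre image of (w_0 : w_k) and of w with its [k]-th coordinate set to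
   0, whence degree 2. *)
pose G j : Qpoly n.+1 :=
  mxvec (\matrix_(a < 2, i < n.+1)
    ((if a == 0 then 'X_ord0 else 'X_k) * (if i == k then 0 else 'X_i))) 0 j.
have FE (a : 'rV_2) (v : 'rV_n.+1) : a 0 0 != 0 ->
    polymap F (segre a v) = a 0 0 *: set_coord k (a 0 1 / a 0 0 * v 0 0) v.
  move=> a0; apply/rowP => i; rewrite !mxE /F; case: eqP => _.
    by rewrite pevalXU segreE mulrA [_ * (_ / _)]mulrC divfK.
  by rewrite pevalXU segreE.
pose a_ (w : 'rV[algC]_n.+1) : 'rV[algC]_2 := \row_j if j == 0 then w 0 0 else w 0 k.
have GE w : polymap G w = segre (a_ w) (set_coord k 0 w).
  apply/rowP => j; case/mxvec_indexP: j => a i.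
  rewrite mxE /G mxvecE mxE pevalM segreE !mxE; congr (_ * _).
    by case: ifP; rewrite pevalXU.
  by case: ifP; rewrite ?peval0 ?pevalXU.
have a0 w : a_ w 0 0 = w 0 0 by rewrite mxE eqxx.
have a1 w : a_ w 0 1 = w 0 k by rewrite mxE.
have k0' : (0 == k) = false by rewrite eq_sym; apply: negPf.
apply: (@isomorphic_polymap _ _ 1 2 _ _ F G).
- by move=> i; rewrite /F; case: ifP => _; apply: dhomogXU.
- move=> j; case/mxvec_indexP: j => a i; rewrite /G mxvecE mxE.
  apply: (@dhomogM _ _ _ 1 _ 1); case: ifP => _; rewrite ?rpred0 //; exact: dhomogXU.
- move=> _ [a [v [/affine_lineE a0' /hZ[Xv vk] ->]]].
  by rewrite FE // qpvar_scale //; apply: Xk.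
- move=> w Xw; rewrite GE; exists (a_ w), (set_coord k 0 w); split=> //.
    by apply/affine_lineE; rewrite a0; apply: X0.
  by apply/hZ; split; [apply: Xk | rewrite mxE eqxx].
- move=> _ [a [v [/affine_lineE a0' /hZ[Xv vk] ->]]].
  exists (v 0 0 * a 0 0); first by rewrite mulf_neq0 ?X0.
  rewrite FE // GE; apply/rowP => j; case/mxvec_indexP: j => b i.
  rewrite mxE !segreE !mxE k0' eqxx.
  have -> : (if i == k then 0
      else a 0 0 * (if i == k then a 0 1 / a 0 0 * v 0 0 else v 0 i)) = a 0 0 * v 0 i.
    by case: eqP => // ->; rewrite vk mulr0.
  have -> : (if b == 0 then a 0 0 * v 0 0
      else a 0 0 * (a 0 1 / a 0 0 * v 0 0)) = a 0 b * v 0 0.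
    case: eqP => [->|/eqP b0] //; have -> : b = 1 by apply/val_inj; case: b b0 => [[|[]]].
    by rewrite mulrA [a 0 0 * _]mulrC divfK.
  by rewrite [a 0 b * v 0 0]mulrC mulrACA.
- move=> w Xw; exists (w 0 0); first exact: X0.
  rewrite GE FE a0 ?X0 // a1 set_coordK mxE k0' divfK ?X0 //.
  by rewrite set_coord_id.
Qed.

(** * Slices and the graph of x = - f0 / f1 *)

Lemma pevalN N (p : Qpoly N) v : peval (- p) v = - peval p v.
Proof. by rewrite /peval !rmorphN. Qed.

Lemma affine_coord_set_coord n (e : 'I_n) c (v : 'rV[algC]_n.+1) i : i != e ->
  affine_coord (set_coord (lift ord0 e) c v) 0 i = affine_coord v 0 i.
Proof. by move=> ie; rewrite !mxE (inj_eq lift_inj) (negPf ie). Qed.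

Lemma peval_set_coord n (S : {set 'I_n}) e (q : Qpoly n) c (v : 'rV[algC]_n.+1) :
    degs_le (fun i => i \in S :\ e) q ->
  peval q (affine_coord (set_coord (lift ord0 e) c v)) = peval q (affine_coord v).
Proof.
move=> hq; rewrite !pevalE; apply: eq_big_seq => m /hq qm; congr (_ * _).
apply: eq_bigr => i _; have [->|ie] := eqVneq i e.
  by have := qm e; rewrite !inE eqxx leqn0 => /eqP->; rewrite !expr0.
by rewrite affine_coord_set_coord.
Qed.

(** Only its trace on the chart v_0 != 0 is meaningful: [homogenize] pads up to [msize q], one more
    than the degree, so the hyperplane at infinity is always included. *)
Definition zaff n (q : Qpoly n) : set 'rV[algC]_n.+1 := pzeros [:: homogenize q].

Lemma zclosed_zaff n (q : Qpoly n) : zclosed (zaff q).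
Proof. exact/zclosed_pzeros1/homogeneous_homogenize. Qed.

Lemma zaffE n (q : Qpoly n) (v : 'rV[algC]_n.+1) : v 0 0 != 0 ->
  zaff q v <-> peval q (affine_coord v) = 0.
Proof.
move=> v0; split=> [[_ /(_ _ (mem_head _ _))]|q0].
  by move/eqP; rewrite peval_homogenize // mulf_eq0 expf_eq0 (negPf v0) andbF => /eqP.
split=> [|_ /[!inE] /eqP->]; first by apply/rV0Pn; exists 0.
by rewrite peval_homogenize // q0 mulr0.
Qed.

(* Eliminated variables are set to 0 rather than removed, so that the ambient *)
(* space stays the same throughout the induction.                             *)
Definition slice_pts n (S : {set 'I_n}) (p : Qpoly n) : set 'rV[algC]_n.+1 :=
  [set v : 'rV[algC]_n.+1 | [/\ v 0 0 != 0, forall i, i \notin S -> v 0 (lift ord0 i) = 0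
             & peval p (affine_coord v) != 0]].

Lemma slice_lc n (S : {set 'I_n}) (p : Qpoly n) :
  exists A B, [/\ zclosed A, zclosed B & slice_pts S p = A `\` B].
Proof.
pose s : seq (Qpoly n.+1) := [seq 'X_(lift ord0 i) | i <- enum (~: S)].
have hs : zclosed (pzeros s).
  by exists s => // _ /mapP[i _ ->]; apply: homogeneousXU.
have [Z hZ] := ex_qpvar_setI (affine_compl p) hs.
have -> : slice_pts S p = Z; last exact: pts_lc.
rewrite hZ; apply/seteqP; split=> v /=.
  move=> [v0 vS pv]; do 2?split=> //; first by apply/rV0Pn; exists 0.
  by move=> _ /mapP[i + ->]; rewrite mem_enum inE pevalXU => /vS.
move=> [[v0 pv] [_ vs]]; split=> // i iS; rewrite -pevalXU; apply: vs.
by apply/mapP; exists i; rewrite // mem_enum inE.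
Qed.

Definition slice n (S : {set 'I_n}) (p : Qpoly n) : qpvar n.+1 := QPVar (slice_lc S p).

Lemma slice_setT n (p : Qpoly n) : slice (finset.setTfor 'I_n) p = affine_compl p.
Proof.
apply/qpvar_inj/seteqP; split=> v /= [] //.
by move=> v0 pv; split=> // i; rewrite inE.
Qed.

(** Where f1 does not vanish, x f1 + f0 = 0 determines x, so forgetting x is invertible. *)
Lemma isomorphic_slice_graph n (S : {set 'I_n}) e (f0 f1 : Qpoly n) (Z : qpvar n.+1) :
    e \in S ->
    degs_le (fun i => i \in S :\ e) f0 -> degs_le (fun i => i \in S :\ e) f1 ->
    Z = slice S f1 `&` zaff ('X_e * f1 + f0) :> set _ ->
  isomorphic Z (slice (S :\ e) f1).
Proof.
move=> eS h0 h1 hZ; pose k := lift ord0 e.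
have k0 : (0 == k) = false by apply/negP => /eqP/(congr1 val).
have ZE (v : 'rV[algC]_n.+1) : pts Z v <-> pts (slice S f1) v /\
    v 0 k / v 0 0 * peval f1 (affine_coord v) + peval f0 (affine_coord v) = 0.
  rewrite hZ; split=> -[Xv]; case: (Xv) => v0 _ _.
    by move/(zaffE _ v0); rewrite pevalD pevalM pevalXU mxE; split.
  by move=> pv; split=> //; apply/(zaffE _ v0); rewrite pevalD pevalM pevalXU mxE.
pose F (i : 'I_n.+1) : Qpoly n.+1 := if i == k then 0 else 'X_i.
(* The section x = - f0 / f1 with denominators cleared; the powers of 'X_ord0 bring all coordinates
   to the common degree [(msize f0 + msize f1).+1]. *)
pose G (i : 'I_n.+1) : Qpoly n.+1 :=
  if i == k then - ('X_ord0 ^+ (msize f1).+1 * homogenize f0)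
  else 'X_i * 'X_ord0 ^+ msize f0 * homogenize f1.
have FE (v : 'rV[algC]_n.+1) : polymap F v = set_coord k 0 v.
  by apply/rowP => i; rewrite !mxE /F; case: eqP; rewrite ?peval0 ?pevalXU.
pose scale (w : 'rV[algC]_n.+1) : algC :=
  w 0 0 ^+ (msize f0 + msize f1) * peval f1 (affine_coord w).
pose height (w : 'rV[algC]_n.+1) : algC :=
  - (w 0 0 * peval f0 (affine_coord w) / peval f1 (affine_coord w)).
have GE (w : 'rV[algC]_n.+1) : w 0 0 != 0 -> peval f1 (affine_coord w) != 0 ->
    polymap G w = scale w *: set_coord k (height w) w.
  move=> w0 w1; apply/rowP => i; rewrite !mxE /G /scale /height; case: eqP => _.
    rewrite pevalN pevalM pevalXn pevalXU peval_homogenize // exprD exprS.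
    move: (peval f0 _) (peval f1 _) (w 0 0) w0 w1 => a b c c0 b0.
    by move: (c ^+ _) (c ^+ _) => x y; field.
  rewrite !pevalM pevalXn !pevalXU peval_homogenize // exprD.
  move: (peval f1 _) (w 0 0) (w 0 i) => a b c.
  by move: (b ^+ _) (b ^+ _) => x y; ring.
have scale0 (w : 'rV[algC]_n.+1) : w 0 0 != 0 -> peval f1 (affine_coord w) != 0 -> scale w != 0.
  by move=> w0 w1; rewrite mulf_neq0 ?expf_neq0.
apply: (@isomorphic_polymap _ _ 1 (msize f0 + msize f1).+1 _ _ F G).
- by move=> i; rewrite /F; case: ifP => _; rewrite ?rpred0 ?dhomogXU.
- move=> i; rewrite /G; case: ifP => _.
    rewrite rpredN addnC -addSn; apply: dhomogM; first exact: dhomogXUn.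
    exact: homogenize_dhomog.
  rewrite -addSn -[(msize f0).+1]add1n; apply: dhomogM; last exact: homogenize_dhomog.
  by apply: dhomogM; [apply: dhomogXU | apply: dhomogXUn].
- move=> v /ZE[[v0 vS v1] _]; rewrite FE; split.
  + by rewrite mxE k0.
  + move=> i; rewrite !inE negb_and negbK mxE (inj_eq lift_inj).
    by case: eqP => //= _; apply: vS.
  + by rewrite (peval_set_coord _ _ h1).
- move=> w [w0 wS w1]; rewrite GE // qpvar_scale ?scale0 //; apply/ZE; split.
    split; rewrite ?(peval_set_coord _ _ h1) ?mxE ?k0 //.
    move=> i iS; rewrite mxE (inj_eq lift_inj); case: eqP => [ie|_].
      by rewrite ie eS in iS.
    by apply: wS; rewrite !inE negb_and iS orbT.
  rewrite (peval_set_coord _ _ h1) (peval_set_coord _ _ h0) !mxE eqxx k0 /height.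
  move: (peval f0 _) (peval f1 _) (w 0 0) w0 w1 => a b c c0 b0.
  by field; rewrite c0.
- move=> v /ZE[[v0 vS v1] pv]; exists (scale v); first exact: scale0.
  rewrite FE GE ?(peval_set_coord _ _ h1) ?mxE ?k0 //.
  rewrite /scale /height (peval_set_coord _ _ h1) (peval_set_coord _ _ h0) set_coordK !mxE k0.
  rewrite (_ : - _ = v 0 k) ?set_coord_id //.
  move: (peval f0 _) (peval f1 _) (v 0 0) (v 0 k) v0 v1 pv => a b c d c0 b0.
  by rewrite addrC => /eqP; rewrite addr_eq0 => /eqP->; field; rewrite b0.
- move=> w [w0 wS w1]; exists (scale w); first exact: scale0.
  rewrite GE // FE -(mulr0 (scale w)) set_coordZ set_coordK; congr (_ *: _).
  have wk : w 0 k = 0 by apply: wS; rewrite !inE eqxx.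
  by rewrite -[X in set_coord k X]wk set_coord_id.
Qed.

(** * Projective space is irreducible, smooth and stably a point *)

Lemma projspace_irreducible k : irreducible (projspace k).
Proof.
split; first by exists (const_mx 1); apply/rV0Pn; exists 0; rewrite mxE oner_eq0.
move=> _ _ [s hs ->] [t ht ->] hAB.
pose zero (p : Qpoly k.+1) := `[< forall v, v != 0 -> peval p v = 0 >].
have [/allP hS|/allPn[]] := boolP (all zero s).
  by left=> v v0; split; first exact: v0; move=> p /hS /asboolP /(_ v v0).
move=> p sp /asboolPn/existsNP[x /not_implyP[x0 /eqP px]].
have [/allP hT|/allPn[]] := boolP (all zero t).
  by right=> v v0; split; first exact: v0; move=> q /hT /asboolP /(_ v v0).
move=> q tq /asboolPn/existsNP[y /not_implyP[y0 /eqP qy]].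
have [i xi] := rV0Pn _ x0.
(* p q is nonzero somewhere on the line through x and y. *)
pose line j : {poly algC} := (x 0 j)%:P + (y 0 j - x 0 j) *: 'X.
pose restr (r : Qpoly k.+1) : {poly algC} :=
  \sum_(m <- msupp r) (ratr r@_m)%:P * \prod_j line j ^+ m j.
have lineE j c : (line j).[c] = (x + c *: (y - x)) 0 j.
  by rewrite /line !hornerE !mxE mulrC.
have restrE r c : (restr r).[c] = peval r (x + c *: (y - x)).
  rewrite horner_sum pevalE; apply: eq_bigr => m _.
  rewrite hornerM hornerC horner_prod; congr (_ * _).
  by apply: eq_bigr => j _; rewrite horner_exp lineE.
have nz (r : {poly algC}) c : r.[c] != 0 -> r != 0.
  by apply: contra_neq => ->; rewrite horner0.
(* The factor [line i] keeps the point to be found away from the zero vector, which represents no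
   projective point. *)
have : line i * (restr p * restr q) != 0.
  rewrite !mulf_neq0 //.
  - by apply: (nz _ 0); rewrite lineE scale0r addr0.
  - by apply: (nz _ 0); rewrite restrE scale0r addr0.
  - by apply: (nz _ 1); rewrite restrE scale1r addrC subrK.
case/closed_nonrootP => c; rewrite /root !hornerM !mulf_eq0 !negb_or lineE !restrE.
case/and3P => zi pz qz.
have z0 : x + c *: (y - x) != 0 by apply/rV0Pn; exists i.
case: (hAB _ z0) => -[_ h]; first by rewrite h ?eqxx in pz.
by rewrite h ?eqxx in qz.
Qed.

Lemma projspace_smooth k : smooth (projspace k).
Proof.
have no_zero : pzeros [:: 1] = set0 :> set 'rV[algC]_k.+1.
  apply/seteqP; split=> v //= -[_ /(_ 1 (mem_head _ _)) /eqP].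
  by rewrite peval1 oner_eq0.
(* A presentation by zero equations: the Jacobian has no rows, and the removed closed set is
   empty. *)
move=> x _; exists 0%N, (fun=> 0), (pzeros [:: 1]); rewrite no_zero; split=> //.
- by case.
- by rewrite -no_zero; apply: zclosed_pzeros1; exists 0%N; apply: dhomog1.
- rewrite !setD0; apply/seteqP; split=> v /= => [v0|[]//]; split=> //.
  by move=> p /codomP[[]].
- by rewrite /row_free flatmx0 mxrank0.
Qed.

Definition projspace_irrvar k : irrvar k.+1 := IrrVar (@projspace_irreducible k).

(** Multiplying by P^0 on one side and by P^k on the other yields the same two factors in opposite
    order, so the exchange is an isomorphism everywhere. *)
Lemma projspace_stably_birational k : stably_birational (projspace k) Defs.point.
Proof.
exists 0%N, k.
exists (Defs.prodv (projspace k) Defs.point), (Defs.prodv Defs.point (projspace k)).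
have nonempty N M (X : qpvar N) (Y : qpvar M) :
    X !=set0 -> Y !=set0 -> Defs.prodv X Y !=set0.
  by move=> [v Xv] [w Yw]; exists (segre v w), v, w.
have pn j : projspace j !=set0 by case: (projspace_irreducible j).
have open_self N (X : qpvar N) : open_in X X.
  exists (pzeros [:: 1]); first by apply: zclosed_pzeros1; exists 0%N; apply: dhomog1.
  apply/seteqP; split=> v /= => [Xv|[]//]; split=> // -[_ /(_ 1 (mem_head _ _))].
  by rewrite peval1 => /eqP; rewrite oner_eq0.
split=> //; try exact: nonempty; exact: isomorphic_prodvC.
Qed.

Lemma zsb_class_projspace k : zsb_class (projspace_irrvar k) = zsb_one.
Proof.
have h : sb_class (projspace_irrvar k) = sb_class (IrrVar irreducible_point).
  exact: (@sb_class_eq _ _ (projspace_irrvar k) (IrrVar irreducible_point)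
            (projspace_stably_birational k)).
by rewrite /zsb_one /zsb_class h.
Qed.

(** * Values of the Larsen-Lunts homomorphism *)

Lemma zsb_mul0 b : zsb_mul 0 b = 0.
Proof. by rewrite /zsb_mul monalg.msupp0 big_nil. Qed.

Section LarsenLunts.
Variables (phi : KVar -> ZSB) (hphi : larsen_lunts phi).

Let phiD : {morph phi : x y / x + y}.
Proof. by case: hphi. Qed.

Let phi1 : phi 1 = zsb_one.
Proof. by case: hphi. Qed.

Lemma larsen_lunts0 : phi 0 = 0.
Proof. by apply: (addrI (phi 0)); rewrite -phiD !addr0. Qed.

Lemma larsen_luntsN x : phi (- x) = - phi x.
Proof. by apply: (addrI (phi x)); rewrite -phiD !subrr larsen_lunts0. Qed.

(* Stated for abstract elements of KVar: rewriting with classes of varieties *)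
(* makes unification unfold the quotient and diverge.                        *)
Lemma larsen_lunts_common_open x y u z c w :
    x = u + z -> y = u + c -> z = w -> phi x = 0 -> phi c = 0 ->
  phi y = - phi w.
Proof.
move=> -> -> ->; rewrite !phiD => /eqP; rewrite addr_eq0 => /eqP -> ->.
by rewrite addr0.
Qed.

Lemma larsen_luntsMn x n : phi (x *+ n) = phi x *+ n.
Proof. by elim: n => [|n IH]; rewrite ?larsen_lunts0 // !mulrS phiD IH. Qed.

Lemma larsen_luntsMz x (n : int) : phi (x *~ n) = phi x *~ n.
Proof.
by case: n => n; rewrite ?NegzE ?mulrNz -?pmulrn ?larsen_luntsN larsen_luntsMn.
Qed.

Lemma larsen_lunts_point N (X : qpvar N) :
  isomorphic X Defs.point -> phi (kclass X) = zsb_one.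
Proof.
by move=> h; exact: etrans (congr1 phi (etrans (kclass_iso h) kclass_point)) phi1.
Qed.

Lemma larsen_lunts_affine_line : phi (kclass affine_line) = 0.
Proof.
have hA : zclosed (pzeros [:: 'X_ord0 : Qpoly 2]).
  exact/zclosed_pzeros1/homogeneousXU.
(* [Z] is the point at infinity (0 : 1) of P^1, and its complement is the affine line. *)
have [Z hZ] := ex_qpvar_setI (projspace 1) hA.
have ZE (v : 'rV[algC]_2) : pts Z v <-> v 0 1 != 0 /\ forall i, i != 1 -> v 0 i = 0.
  rewrite hZ; split.
    move=> [/= v0 [_ /(_ _ (mem_head _ _))]]; rewrite pevalXU => v00.
    have vi i : i != 1 -> v 0 i = 0.
      by move=> i1; rewrite -v00; congr (v 0 _); apply/val_inj; case: i i1 => [[|[]]].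
    by split=> //; apply: contra_neq v0 => v1; apply/rowP => i;
       rewrite mxE; case: (eqVneq i 1) => [->|/vi].
  move=> [v1 vi]; have v0 : v != 0 by apply/rV0Pn; exists 1.
  by split=> //; split=> // _ /[!inE] /eqP->; rewrite pevalXU vi.
have e : kclass (projspace 1) = kclass affine_line + 1.
  rewrite -kclass_point -(kclass_iso (isomorphic_coord_point ZE)).
  apply: kclass_split hA hZ _; apply/seteqP; split=> v.
    move=> /affine_lineE v0; split; first by apply/rV0Pn; exists 0.
    by move=> [_ /(_ _ (mem_head _ _))]; rewrite pevalXU => /eqP; rewrite (negPf v0).
  move=> [/= vn0 h]; apply/affine_lineE; apply: contra_notN h => /eqP v0.
  by split=> // _ /[!inE] /eqP->; rewrite pevalXU.
have hP : phi (kclass (projspace 1)) = zsb_one.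
  rewrite -(zsb_class_projspace 1).
  case: hphi => _ _ _ hsm; exact: hsm (projspace_irrvar 1) (@zclosed_all 2) (@projspace_smooth 1).
have h : phi (kclass affine_line) + zsb_one = zsb_one.
  transitivity (phi (kclass affine_line + 1)).
    transitivity (phi (kclass affine_line) + phi 1); last exact/esym/phiD.
    exact: (congr1 (fun z : ZSB => phi (kclass affine_line) + z) (esym phi1)).
  exact: etrans (congr1 phi (esym e)) hP.
exact: (addIr zsb_one (etrans h (esym (add0r zsb_one)))).
Qed.

(** Such an [X] is the product of A^1 with its section at coordinate 0, so its class is a multiple
    of the class of A^1. *)
Lemma larsen_lunts_cylinder n (X : qpvar n.+1) (e : 'I_n) :
    (forall v, pts X v -> v 0 0 != 0) ->
    (forall c v, pts X v -> pts X (set_coord (lift ord0 e) c v)) ->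
  phi (kclass X) = 0.
Proof.
move=> X0 Xe; have hA : zclosed (pzeros [:: 'X_(lift ord0 e) : Qpoly n.+1]).
  exact/zclosed_pzeros1/homogeneousXU.
have [Z hZ] := ex_qpvar_setI X hA.
have ZE v : pts Z v <-> pts X v /\ v 0 (lift ord0 e) = 0.
  rewrite hZ; split=> -[Xv].
    by move=> [_ /(_ _ (mem_head _ _))]; rewrite pevalXU.
  move=> ve; split=> //; split; first exact: qpvar_neq0 Xv.
  by move=> _ /[!inE] /eqP->; rewrite pevalXU.
rewrite -(kclass_iso (isomorphic_cylinder _ X0 Xe ZE)) // kclass_prod.
have [_ phiM _ _] := hphi; apply: etrans (phiM _ _) _.
exact: etrans (congr1 (zsb_mul^~ _) larsen_lunts_affine_line) (zsb_mul0 _).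
Qed.

Lemma larsen_lunts_slice n (S : {set 'I_n}) e (f1 f0 : Qpoly n) :
    e \in S ->
    degs_le (fun i => i \in S :\ e) f1 -> degs_le (fun i => i \in S :\ e) f0 ->
  phi (kclass (slice S ('X_e * f1 + f0))) = - phi (kclass (slice (S :\ e) f1)).
Proof.
move=> eS h1 h0; set p := _ + f0; pose k := lift ord0 e.
have k0 : (0 == k) = false by apply/negP => /eqP/(congr1 val).
have Sk c (v : 'rV[algC]_n.+1) i : i \notin S ->
    set_coord k c v 0 (lift ord0 i) = v 0 (lift ord0 i).
  move=> iS; rewrite mxE (inj_eq lift_inj); case: eqP => // ie.
  by rewrite ie eS in iS.
have pE v : peval p (affine_coord v) =
    affine_coord v 0 e * peval f1 (affine_coord v) + peval f0 (affine_coord v).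
  by rewrite pevalD pevalM pevalXU.
(* [U] is the common open part, [Z] the rest of [slice S f1], and [C] the rest of [slice S p]. *)
have [Z hZ] := ex_qpvar_setI (slice S f1) (zclosed_zaff p).
have [U hU] := ex_qpvar_setD (slice S f1) (zclosed_zaff p).
have [C hC] := ex_qpvar_setI (slice S p) (zclosed_zaff f1).
have UE : U = slice S p `\` zaff f1 :> set _.
  rewrite hU; apply/seteqP; split=> v [[v0 vS v1] v2].
    split; last by move/(zaffE _ v0)/eqP; rewrite (negPf v1).
    by split=> //; apply/eqP => /(zaffE _ v0).
  split; last by move/(zaffE _ v0)/eqP; rewrite (negPf v1).
  by split=> //; apply/eqP => /(zaffE _ v0).
(* On [C], f1 vanishes, so the condition p != 0 becomes f0 != 0, which does not see the coordinate
   [e]. *)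
have C0 : phi (kclass C) = 0.
  apply: (@larsen_lunts_cylinder _ _ e) => [v|c v]; rewrite hC => -[[v0 vS pv]] //.
  move=> /(zaffE _ v0) v1; have v0' : set_coord k c v 0 0 != 0 by rewrite mxE k0.
  rewrite pE v1 mulr0 add0r in pv.
  split; last by apply/zaffE; rewrite ?(peval_set_coord _ _ h1).
  split=> // [i iS|]; first by rewrite Sk ?vS.
  by rewrite pE (peval_set_coord _ _ h1) (peval_set_coord _ _ h0) v1 mulr0 add0r.
have X0 : phi (kclass (slice S f1)) = 0.
  apply: (@larsen_lunts_cylinder _ _ e) => [v|c v] [v0 vS v1] //.
  split=> [|i iS|]; first by rewrite mxE k0.
    by rewrite Sk ?vS.
  by rewrite (peval_set_coord _ _ h1).
have eX := kclass_split (zclosed_zaff p) hZ hU.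
have eV := kclass_split (zclosed_zaff f1) hC UE.
have eZ := kclass_iso (isomorphic_slice_graph eS h0 h1 hZ).
exact: larsen_lunts_common_open eX eV eZ X0 C0.
Qed.

Lemma larsen_lunts_multiaffine n (S : {set 'I_n}) (p : Qpoly n) :
    degs_le (fun i => i \in S) p ->
  exists k : int, phi (kclass (slice S p)) = zsb_one *~ k.
Proof.
have [m] := ubnP #|S|; elim: m => // m IH in S p *; rewrite ltnS => Sm hp.
(* With no variable left [p] is constant: the slice is empty if it is 0, and otherwise the origin of
   the affine chart. *)
have [S0|[e eS]] := set_0Vmem S.
  have {}hp : p = p@_0%MM *: 1.
    by apply/degs_le_const/degs_leW/hp => i; rewrite S0 inE.
  have ev v : peval p v = ratr p@_0%MM.
    by rewrite hp pevalZ peval1 mulr1 mcoeffZ mcoeff1 eqxx mulr1.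
  have [c0|c0] := eqVneq p@_0%MM 0.
    exists 0; rewrite mulr0z kclass_set0 ?larsen_lunts0 //.
    by apply/seteqP; split=> v // -[_ _]; rewrite ev c0 rmorph0 eqxx.
  exists 1; rewrite mulr1z; apply: larsen_lunts_point.
  apply: (@isomorphic_coord_point _ _ ord0) => v; split=> [[v0 vS _]|[v0 vi]].
    split=> // i; case: (unliftP ord0 i) => [j ->|->] //.
    by rewrite vS // S0 inE.
  by split=> // [i _|]; [apply: vi | rewrite ev fmorph_eq0].
have [f1 [f0 [-> h1 h0]]] := degs_le_split eS hp.
have [|k hk] := IH _ _ _ h1.
  by apply: leq_trans Sm; rewrite [in X in (_ < X)%N](cardsD1 e) eS.
by exists (- k); rewrite larsen_lunts_slice // hk mulrNz.
Qed.

End LarsenLunts.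

(** * The empty graph and the image of the graph ring *)

(** It has no components, so its polynomial is the empty product 1 in zero variables, and its
    complement is A^0. *)
Definition empty_graph : graph := 
  @Graph void 0 (fun i => let: Ordinal _ lt_i0 := i in False_rect _ (notF lt_i0)).

Theorem theorem1p1 (phi : KVar -> ZSB) (hphi : larsen_lunts phi) :
  phi @` graph_ring = [set zsb_one *~ n | n in [set: int]].
Proof.
have phiD : {morph phi : x y / x + y} by case: hphi.
apply/seteqP; split=> [_ [_ [s ->] <-]|_ [n _ <-]].
  (* Integer multiples of the unit are closed under integer combinations, so it suffices to treat
     one graph at a time. *)
  elim: s => [|[m G] s [k _ hk]].
    by exists 0 => //; rewrite big_nil larsen_lunts0.
  have [l hl] : exists l : int, phi (kclass (graph_compl G)) = zsb_one *~ l.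
    rewrite /graph_compl -slice_setT; apply: (larsen_lunts_multiaffine hphi).
    by apply: (degs_leW _ (@graph_poly_degs_le G)) => i; rewrite inE.
  exists (l * m + k) => //.
  by rewrite big_cons phiD larsen_luntsMz // hl -hk mulrzDr mulrzA.
exists (kclass (graph_compl empty_graph) *~ n); last first.
  rewrite larsen_luntsMz //; congr (_ *~ _).
  apply: (larsen_lunts_point hphi).
  apply: (@isomorphic_coord_point _ _ ord0) => v; split.
    by move=> [v0 _]; split=> // i; rewrite ord1.
  move=> [v0 _]; split=> //; rewrite /graph_poly big1 ?peval1 ?oner_neq0 //.
  by move=> C /imsetP[[]].
by exists [:: (n, empty_graph)]; rewrite big_seq1.
Qed.
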